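(* Let $A$ be a unital ring, let $S$ be a not necessarily cancellative left Ore, left reversible monoid with enveloping group $G=S^{-1}S$, let $\lambda: S\rightarrow G$ be the natural map, let $\widetilde{S}=\lambda(S)$, and let $\alpha: S\rightarrow \mathrm{Endr}(A)$ be an action of $S$ on $A$. Let $I:=\bigcup_{s'\in S}\ker(\alpha_{s'})$. Then $\alpha$ extends to an action $\widehat{\alpha}: G\rightarrow \mathrm{Aut}\big(\widetilde{S}^{-1}(\widetilde{S}_-(A/I)\widetilde{S}_+)\big)$, and there exist a nonzero idempotent $e\in \widetilde{S}^{-1}(\widetilde{S}_-(A/I)\widetilde{S}_+)$ such that $\widehat{\alpha}_s(e)\le e$ for all $s\in S$, and an $S$-equivariant surjective ring homomorphism $$\Phi: S^{\mathrm{op}}*_\alpha A*_\alpha S\;\twoheadrightarrow\; e\big((\widetilde{S}^{-1}(\widetilde{S}_-(A/I)\widetilde{S}_+))*_{\widehat{\alpha}}G\big)e.$$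
   Context: For a unital ring $A$, $\mathrm{Endr}(A)$ is the monoid of not necessarily unital ring endomorphisms of $A$; an action of a monoid $S$ on $A$ is a monoid homomorphism $\alpha: S\to \mathrm{Endr}(A)$, $s\mapsto\alpha_s$. Put $p_s=\alpha_s(1)$, an idempotent. A monoid $S$ is left Ore if for all $s,t\in S$ there are $\hat s,\hat t\in S$ with $\hat s t=\hat t s$. It is left reversible if $ts=us$ in $S$ implies $s't=s'u$ for some $s'\in S$. For such $S$ the group of left fractions $G=S^{-1}S$ (monoid localization, enveloping group) exists, with natural map $\lambda: S\to G$ (not injective in general); $\widetilde S=\lambda(S)$ is a cancellative left Ore monoid with enveloping group $G$. Fractional skew monoid ring: for a left Ore, left reversible monoid $S$ acting on $A$, $S^{\mathrm{op}}*_\alpha A*_\alpha S$ is the unital ring $R$ with a unital ring homomorphism $\phi: A\to R$ and monoid homomorphisms $S^{\mathrm{op}}\to R$, $s\mapsto s_-$, and $S\to R$, $s\mapsto s_+$, universal with respect to: (1) $s_+\phi(a)=\phi(\alpha_s(a))s_+$; (2) $\phi(a)s_-=s_-\phi(\alpha_s(a))$; (3) $s_-s_+=1$; (4) $s_+s_-=\phi(p_s)$, for all $a\in A$, $s\in S$. $I$ is a two-sided ideal of $A$ and $\alpha$ induces an action $\alpha'$ of $S$ on $A/I$ by injective endomorphisms; $\alpha'_s$ depends only on $\lambda(s)$, so $\alpha'$ is also an action of $\widetilde S$ on $A/I$. When an action on a ring is by injective endomorphisms, $\phi$ is injective and the ring is identified with its image. $\widetilde S_-(A/I)\widetilde S_+$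 denotes the subset $\{s_-as_+ : s\in \widetilde S, a\in A/I\}$ of $\widetilde S^{\mathrm{op}}*_{\alpha'}(A/I)*_{\alpha'}\widetilde S$; it is a unital subring containing $A/I$, and $\widetilde S$ acts on it by the injective endomorphisms $\overline{\alpha}_t(x)=t_+xt_-$. For a ring $B$ with an action $\beta$ of $\widetilde S$ by injective endomorphisms, $\widetilde S^{-1}B=(\widetilde S\times B)/\sim$, where $(s_1,b_1)\sim(s_2,b_2)$ iff there are $t_1,t_2\in \widetilde S$ with $t_1s_1=t_2s_2$ and $\beta_{t_1}(b_1)=\beta_{t_2}(b_2)$; $[s,b]$ is the class of $(s,b)$. For $t_1s_1=t_2s_2$, $[s_1,b_1]+[s_2,b_2]=[t_1s_1,\beta_{t_1}(b_1)+\beta_{t_2}(b_2)]$ and $[s_1,b_1][s_2,b_2]=[t_1s_1,\beta_{t_1}(b_1)\beta_{t_2}(b_2)]$. Here $B=\widetilde S_-(A/I)\widetilde S_+$, $\beta=\overline{\alpha}$. For $s\in S$, $\widehat\alpha_s$ means $\widehat\alpha_{\lambda(s)}$. ''$\alpha$ extends to $\widehat\alpha$'' means $\widehat{\alpha}_s([1,a+I])=[1,\alpha_s(a)+I]$ for all $s\in S$, $a\in A$. For idempotents, $e\le f$ means $e=ef=fe$. For a group $G$ acting on a ring $C$ by automorphisms $\widehat\alpha$, $C*_{\widehat\alpha}G=\bigoplus_{g\in G}Cg$ is the skew group ring with $(cg)(dh)=c\,\widehat\alpha_g(d)\,gh$. $\Phi$ is $S$-equivariant if it intertwines the canonical actions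 of $S$: $\Phi(s_+xs_-)=\lambda(s)\Phi(x)\lambda(s)^{-1}$, where conjugation by $g\in G$ on $C*_{\widehat\alpha}G$ is the automorphism $ch\mapsto\widehat\alpha_g(c)\,ghg^{-1}$.
   Formalization: The idempotent e is claimed to be nonzero only when 1 is not in I, i.e. I ≠ A; if I = A (e.g. some α_s = 0), the ring S̃^{-1}(S̃_-(A/I)S̃_+) is zero and has no nonzero idempotent. All other conclusions hold unconditionally. *)

(* Defs.v *)
From HB Require Import structures.
From mathcomp Require Import all_boot all_algebra.
From mathcomp Require Import boolp finmap monalg.

Set Implicit Arguments.
Unset Strict Implicit.
Unset Printing Implicit Defensive.

Import GRing.Theory.

Local Open Scope ring_scope.
Local Open Scope quotient_scope.

(* -------------------------------------------------------------------- *)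
Definition left_ore (S : monoidType) : Prop :=
  forall s t : S, exists s' t' : S, (s' * t = t' * s)%g.

Definition left_reversible (S : monoidType) : Prop :=
  forall s t u : S, (t * s = u * s)%g -> exists s' : S, (s' * t = s' * u)%g.

HB.mixin Record Monoid_isRevOre S of Monoid S := {
  oreP_subproof : left_ore S;
  revP_subproof : left_reversible S
}.

#[short(type="revOreMonoidType")]
HB.structure Definition RevOreMonoid := {S of Monoid S & Monoid_isRevOre S}.

Lemma oreP (S : revOreMonoidType) : left_ore S.
Proof. exact: oreP_subproof. Qed.

Lemma revP (S : revOreMonoidType) : left_reversible S.
Proof. exact: revP_subproof. Qed.

(* -------------------------------------------------------------------- *)
(* The group of left fractions S^-1 S: the pair (s, t) stands for s^-1 t,
   and (s, t) ~ (s', t') when the two pairs have a common left multiple.  *)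
Section Fractions.
Variable S : revOreMonoidType.
Implicit Types (s t u v : S) (x y z : S * S).
Local Open Scope group_scope.

Definition frac_rel x y : bool :=
  `[< exists u v, u * x.1 = v * y.1 /\ u * x.2 = v * y.2 >].

Lemma frac_relP x y :
  reflect (exists u v, u * x.1 = v * y.1 /\ u * x.2 = v * y.2) (frac_rel x y).
Proof. exact: asboolP. Qed.

Lemma frac_rel_refl : reflexive frac_rel.
Proof. by move=> x; apply/frac_relP; exists 1, 1. Qed.

Lemma frac_rel_sym : symmetric frac_rel.
Proof.
by move=> x y; apply/frac_relP/frac_relP => -[u [v [e1 e2]]]; exists v, u.
Qed.

Lemma frac_rel_trans : transitive frac_rel.
Proof.
move=> y x z /frac_relP[u [v [e1 e2]]] /frac_relP[u' [v' [e1' e2']]].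
have [w [w' ew]] := oreP u' v; apply/frac_relP; exists (w * u), (w' * v').
by rewrite -!mulgA e1 e2 -e1' -e2' !mulgA ew.
Qed.

Definition frac_equiv := EquivRel frac_rel frac_rel_refl frac_rel_sym
  frac_rel_trans.

Definition lfrac := {eq_quot frac_equiv}.
HB.instance Definition _ : EqQuotient _ frac_equiv lfrac :=
  EqQuotient.on lfrac.
HB.instance Definition _ := Choice.on lfrac.

Definition mklfrac s t : lfrac := \pi_lfrac (s, t).

Lemma mkfrac_eq s t s' t' : mklfrac s t = mklfrac s' t' <->
  exists u v, u * s = v * s' /\ u * t = v * t'.
Proof.
split; first by move/eqmodP/frac_relP.
by move=> h; apply/eqmodP/frac_relP.
Qed.

Lemma mkfracMl u s t : mklfrac (u * s) (u * t) = mklfrac s t.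
Proof. by apply/mkfrac_eq; exists 1, u; rewrite !mul1g. Qed.

Lemma fracP (g : lfrac) : exists s t, g = mklfrac s t.
Proof. by elim/quotW: g => -[s t]; exists s, t. Qed.

Definition ore_pair s t : S * S :=
  let: exist s' h := cid (oreP s t) in let: exist t' _ := cid h in (s', t').

Lemma ore_pairP s t : (ore_pair s t).1 * t = (ore_pair s t).2 * s.
Proof. by rewrite /ore_pair; case: cid => s' h; case: cid. Qed.

(* s^-1 t s'^-1 t' = (p s)^-1 (q t') whenever p t = q s' *)
Definition frac_mul0 x y : lfrac :=
  let p := ore_pair y.1 x.2 in mklfrac (p.1 * x.1) (p.2 * y.2).

Lemma frac_mul0E s t s' t' p q : p * t = q * s' ->
  frac_mul0 (s, t) (s', t') = mklfrac (p * s) (q * t').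
Proof.
rewrite /frac_mul0 /=; set r := ore_pair _ _; have := ore_pairP s' t.
rewrite -/r; move: r.1 r.2 => p' q' {r} e' e.
have [w [w' ew]] := oreP p p'.
have /revP [v ev] : (w * q') * s' = (w' * q) * s'.
  by rewrite -!mulgA -e -e' !mulgA ew.
apply/mkfrac_eq; exists (v * w), (v * w'); split.
  by rewrite !mulgA -(mulgA v w p') ew !mulgA.
by rewrite !mulgA -(mulgA v w q') ev !mulgA.
Qed.

Definition frac_mul (g h : lfrac) : lfrac := frac_mul0 (repr g) (repr h).

Lemma frac_mulE s t s' t' p q : p * t = q * s' ->
  frac_mul (mklfrac s t) (mklfrac s' t') = mklfrac (p * s) (q * t').
Proof.
rewrite /frac_mul /mklfrac; case: piP => -[a b] /mkfrac_eq[u [v [e1 e2]]].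
case: piP => -[c d] /mkfrac_eq[u' [v' [e1' e2']]] e.
have [w [x ew]] := oreP (v' * c) (v * b).
rewrite (@frac_mul0E _ _ _ _ (w * v) (x * v')); last by rewrite -!mulgA.
rewrite -[LHS]/(mklfrac _ _) -!mulgA -e1 -e2' !mulgA.
rewrite -(@frac_mul0E s t s' t'); first exact: frac_mul0E.
by rewrite -!mulgA e2 e1' ew.
Qed.

Lemma frac_mul_chain s t u :
  frac_mul (mklfrac s t) (mklfrac t u) = mklfrac s u.
Proof. by rewrite (@frac_mulE _ _ _ _ 1 1) // !mul1g. Qed.

Lemma frac_common (g h : lfrac) :
  exists s t u, g = mklfrac s t /\ h = mklfrac t u.
Proof.
have [s [t ->]] := fracP g; have [s' [t' ->]] := fracP h.
have [p [q e]] := oreP s' t; exists (p * s), (p * t), (q * t').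
by rewrite mkfracMl e mkfracMl.
Qed.

Lemma frac_mulA : associative frac_mul.
Proof.
move=> g h k; have [s [t [u [-> ->]]]] := frac_common g h.
have [s' [t' ->]] := fracP k; have [p [q e]] := oreP s' u.
rewrite -(mkfracMl p s t) -(mkfracMl p t u) -(mkfracMl q s') e.
by rewrite !frac_mul_chain.
Qed.

Definition frac_one : lfrac := mklfrac 1 1.

Lemma frac_oneE s : frac_one = mklfrac s s.
Proof. by rewrite /frac_one -(mkfracMl s 1 1) mulg1. Qed.

Lemma frac_mul1 : left_id frac_one frac_mul.
Proof.
by move=> g; have [s [t ->]] := fracP g; rewrite (frac_oneE s) frac_mul_chain.
Qed.

Lemma frac_mulr1 : right_id frac_one frac_mul.
Proof.
by move=> g; have [s [t ->]] := fracP g; rewrite (frac_oneE t) frac_mul_chain.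
Qed.

Definition frac_inv (g : lfrac) : lfrac := mklfrac (repr g).2 (repr g).1.

Lemma frac_invE s t : frac_inv (mklfrac s t) = mklfrac t s.
Proof.
rewrite /frac_inv /mklfrac; case: piP => -[a b] /mkfrac_eq[u [v [e1 e2]]] /=.
by apply/mkfrac_eq; exists v, u.
Qed.

Lemma frac_mulV : left_inverse frac_one frac_inv frac_mul.
Proof.
move=> g; have [s [t ->]] := fracP g.
by rewrite frac_invE frac_mul_chain (frac_oneE t).
Qed.

Lemma frac_mulrV : right_inverse frac_one frac_inv frac_mul.
Proof.
move=> g; have [s [t ->]] := fracP g.
by rewrite frac_invE frac_mul_chain (frac_oneE s).
Qed.

HB.instance Definition _ := isGroup.Build lfrac frac_mulA frac_mul1 frac_mulr1
  frac_mulV frac_mulrV.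

Definition lam s : lfrac := mklfrac 1 s.

Lemma lam_monoid_morphism : monoid.monoid_morphism lam.
Proof.
split=> // s t; rewrite /lam -(mkfracMl s 1 t) mulg1.
exact/esym/frac_mul_chain.
Qed.

HB.instance Definition _ :=
  monoid.isUMagmaMorphism.Build S lfrac lam lam_monoid_morphism.

Lemma mkfracE s t : mklfrac s t = (lam s)^-1 * lam t.
Proof.
by rewrite -[(lam s)^-1]/(frac_inv _) frac_invE [RHS]frac_mul_chain.
Qed.

Lemma lam_eq s t : lam s = lam t <-> exists u, u * s = u * t.
Proof.
split=> [/mkfrac_eq[u [v []]]|[u e]].
  by rewrite !mulg1 => -> ?; exists v.
by apply/mkfrac_eq; exists u, u.
Qed.

Lemma frac_univ (H : groupType) (f : monoid.UMagmaMorphism.type S H) :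
  exists h : monoid.UMagmaMorphism.type lfrac H, h \o lam =1 f /\
    forall h' : monoid.UMagmaMorphism.type lfrac H, h' \o lam =1 f -> h' =1 h.
Proof.
pose h0 (g : lfrac) := (f (repr g).1)^-1 * f (repr g).2.
have h0E s t : h0 (mklfrac s t) = (f s)^-1 * f t.
  rewrite /h0 /mklfrac; case: piP => -[a b] /mkfrac_eq[u [v [e1 e2]]] /=.
  have : f u * f s = f v * f a by rewrite -!gmulfM e1.
  have : f u * f t = f v * f b by rewrite -!gmulfM e2.
  move=> /(canRL (mulKg _)) ft /(canRL (mulKg _)) fs; move: ft fs.
  by move=> -> ->; rewrite !invgM invgK -!mulgA mulVKg mulKg.
have h0M : monoid.monoid_morphism h0.
  split=> [|g k]; first by rewrite -[1]/(mklfrac 1 1) h0E mulVg.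
  have [s [t [u [-> ->]]]] := frac_common g k.
  by rewrite [_ * _]frac_mul_chain !h0E mulgA mulgK.
pose m := monoid.isUMagmaMorphism.Build lfrac H h0 h0M.
pose h : monoid.UMagmaMorphism.type lfrac H := HB.pack h0 m.
exists h; split=> [s|h' h'f g]; first by rewrite /= h0E gmulf1 invg1 mul1g.
have [s [t ->]] := fracP g; rewrite [RHS]h0E mkfracE gmulfM.
by rewrite gmulfV; congr (_^-1 * _); apply: h'f.
Qed.

End Fractions.

(* -------------------------------------------------------------------- *)
Section LamImage.
Variable S : revOreMonoidType.
Local Open Scope group_scope.

Definition lam_image : pred (lfrac S) := fun g => `[< exists s, lam s = g >].

Lemma lam_image_closed : umagma_closed lam_image.
Proof.
split; first by apply/asboolP; exists 1; rewrite gmulf1.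
move=> _ _ /asboolP[s <-] /asboolP[t <-]; apply/asboolP; exists (s * t).
exact: gmulfM.
Qed.

Record tilde := Tilde {tilde_val : lfrac S; tilde_valP : lam_image tilde_val}.

HB.instance Definition _ := [isSub for tilde_val].
HB.instance Definition _ := [Choice of tilde by <:].
HB.instance Definition _ :=
  SubChoice_isSubMonoid.Build (lfrac S) lam_image tilde lam_image_closed.

Lemma lamt_subproof s : lam_image (lam s).
Proof. by apply/asboolP; exists s. Qed.

Definition lamt s : tilde := Tilde (lamt_subproof s).

Lemma lamtM s t : lamt (s * t) = lamt s * lamt t.
Proof. by apply: val_inj; rewrite /= gmulfM. Qed.

Lemma lamt1 : lamt 1 = 1.
Proof. by apply: val_inj. Qed.

Lemma lamtP (x : tilde) : exists s, lamt s = x.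
Proof. by have [s e] := asboolP _ (valP x); exists s; apply: val_inj. Qed.

Lemma tilde_left_ore : left_ore tilde.
Proof.
move=> x y; have [s <-] := lamtP x; have [t <-] := lamtP y.
have [s' [t' e]] := oreP s t.
by exists (lamt s'), (lamt t'); rewrite -!lamtM e.
Qed.

Lemma tilde_mulgI : right_injective (@monoid.mul tilde).
Proof. by move=> x y z /(congr1 val) /mulgI e; apply: val_inj. Qed.

Lemma tilde_mulIg : left_injective (@monoid.mul tilde).
Proof. by move=> x y z /(congr1 val) /mulIg e; apply: val_inj. Qed.

Lemma tilde_left_reversible : left_reversible tilde.
Proof. by move=> x y z /tilde_mulIg->; exists 1. Qed.

HB.instance Definition _ :=
  Monoid_isRevOre.Build tilde tilde_left_ore tilde_left_reversible.

End LamImage.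

(* -------------------------------------------------------------------- *)
(* The endomorphisms in Endr(A) need not preserve 1.                      *)
Record endr_action (S : monoidType) (A : pzRingType) := EndrAction {
  eact :> S -> A -> A;
  eactD : forall s, {morph eact s : a b / a + b};
  eactM : forall s, {morph eact s : a b / a * b};
  eact1 : eact 1%g =1 id;
  eact_mul : forall s t, eact (s * t)%g =1 eact s \o eact t
}.

Section EndrActionTheory.
Variables (S : monoidType) (A : pzRingType) (alpha : endr_action S A).

Lemma eact0 s : alpha s 0 = 0.
Proof. by apply: (addrI (alpha s 0)); rewrite -eactD !addr0. Qed.

Lemma eactN s : {morph alpha s : a / - a}.
Proof.
by move=> a; apply: (addrI (alpha s a)); rewrite -eactD !subrr eact0.
Qed.

Lemma eactB s : {morph alpha s : a b / a - b}.
Proof. by move=> a b; rewrite eactD eactN. Qed.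

End EndrActionTheory.

(* -------------------------------------------------------------------- *)
Section UnionOfKernels.
Variables (S : revOreMonoidType) (A : pzRingType) (alpha : endr_action S A).

(* The two-sided ideal I, union of the kernels of the alpha_s             *)
Definition kerU : {pred A} := fun a => `[< exists s, alpha s a = 0 >].

Lemma kerUP a : reflect (exists s, alpha s a = 0) (a \in kerU).
Proof. exact: asboolP. Qed.

Lemma kerU_zmod_closed : zmod_closed kerU.
Proof.
split; first by apply/kerUP; exists 1%g; rewrite eact0.
move=> a b /kerUP[s sa] /kerUP[t tb]; have [s' [t' e]] := oreP s t.
apply/kerUP; exists (s' * t)%g.
by rewrite eactB {1}e !eact_mul /= sa tb !eact0 subr0.
Qed.

HB.instance Definition _ := GRing.isZmodClosed.Build A kerU kerU_zmod_closed.

Lemma kerU_mull a b : b \in kerU -> a * b \in kerU.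
Proof. by case/kerUP=> s e; apply/kerUP; exists s; rewrite eactM e mulr0. Qed.

Lemma kerU_mulr a b : a \in kerU -> a * b \in kerU.
Proof. by case/kerUP=> s e; apply/kerUP; exists s; rewrite eactM e mul0r. Qed.

Lemma kerU_act s a : (alpha s a \in kerU) = (a \in kerU).
Proof.
apply/kerUP/kerUP => -[t e]; first by exists (t * s)%g; rewrite eact_mul.
have [t' [s' e']] := oreP t s; exists t'.
by rewrite -[LHS]/((alpha t' \o alpha s) a) -eact_mul e' eact_mul /= e eact0.
Qed.

Definition kerU_quot := Quotient.quot kerU.
HB.instance Definition _ := GRing.Zmodule.on kerU_quot.
Definition kerU_pi (a : A) : kerU_quot := \pi_(Quotient.quot kerU) a.

Lemma kerU_piE a b : kerU_pi a = kerU_pi b <-> a - b \in kerU.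
Proof. by rewrite Quotient.idealrBE; split=> [/eqP|/eqP]. Qed.

Lemma kerU_piP (x : kerU_quot) : exists a, x = kerU_pi a.
Proof. by elim/quotW: x => a; exists a. Qed.

Lemma kerU_piD : {morph kerU_pi : a b / a + b}.
Proof. by move=> a b; rewrite /kerU_pi; exact: raddfD. Qed.

Lemma kerU_pi0 : kerU_pi 0 = 0.
Proof. exact: raddf0. Qed.

Lemma kerU_repr a : repr (kerU_pi a) - a \in kerU.
Proof. by apply/kerU_piE; rewrite /kerU_pi reprK. Qed.

Definition kerU_mul (x y : kerU_quot) : kerU_quot :=
  kerU_pi (repr x * repr y).

Lemma kerU_piM a b : kerU_mul (kerU_pi a) (kerU_pi b) = kerU_pi (a * b).
Proof.
apply/kerU_piE; set a' := repr _; set b' := repr _.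
have -> : a' * b' - a * b = (a' - a) * b' + a * (b' - b).
  by rewrite mulrBl mulrBr addrA subrK.
apply: rpredD; first exact/kerU_mulr/kerU_repr.
exact/kerU_mull/kerU_repr.
Qed.

Lemma kerU_mulA : associative kerU_mul.
Proof.
move=> x y z; have [a ->] := kerU_piP x; have [b ->] := kerU_piP y.
by have [c ->] := kerU_piP z; rewrite !kerU_piM mulrA.
Qed.

Lemma kerU_mul1 : left_id (kerU_pi 1) kerU_mul.
Proof. by move=> x; have [a ->] := kerU_piP x; rewrite kerU_piM mul1r. Qed.

Lemma kerU_mulr1 : right_id (kerU_pi 1) kerU_mul.
Proof. by move=> x; have [a ->] := kerU_piP x; rewrite kerU_piM mulr1. Qed.

Lemma kerU_mulDl : left_distributive kerU_mul +%R.
Proof.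
move=> x y z; have [a ->] := kerU_piP x; have [b ->] := kerU_piP y.
by have [c ->] := kerU_piP z; rewrite -kerU_piD !kerU_piM -kerU_piD mulrDl.
Qed.

Lemma kerU_mulDr : right_distributive kerU_mul +%R.
Proof.
move=> x y z; have [a ->] := kerU_piP x; have [b ->] := kerU_piP y.
by have [c ->] := kerU_piP z; rewrite -kerU_piD !kerU_piM -kerU_piD mulrDr.
Qed.

HB.instance Definition _ := GRing.Zmodule_isPzRing.Build kerU_quot
  kerU_mulA kerU_mul1 kerU_mulr1 kerU_mulDl kerU_mulDr.

Definition quot_act (s : S) (x : kerU_quot) : kerU_quot :=
  kerU_pi (alpha s (repr x)).

Lemma quot_actE s a : quot_act s (kerU_pi a) = kerU_pi (alpha s a).
Proof. by apply/kerU_piE; rewrite -eactB kerU_act kerU_repr. Qed.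

Lemma quot_act_inj s : injective (quot_act s).
Proof.
move=> x y; have [a ->] := kerU_piP x; have [b ->] := kerU_piP y.
by rewrite !quot_actE => /kerU_piE; rewrite -eactB kerU_act => /kerU_piE.
Qed.

Lemma quot_act_lam s t : lam s = lam t -> quot_act s =1 quot_act t.
Proof.
case/lam_eq=> u e x; have [a ->] := kerU_piP x; rewrite !quot_actE.
apply/kerU_piE/kerUP; exists u; rewrite eactB.
by rewrite -[alpha u _]eact_mul -[alpha u (alpha t a)]eact_mul e subrr.
Qed.

(* alpha'_x for x = lambda(s); it does not depend on s by quot_act_lam.   *)
Definition tilde_quot_act0 (x : tilde S) : kerU_quot -> kerU_quot :=
  quot_act (sval (cid (lamtP x))).

Lemma tilde_quot_act0E s a :
  tilde_quot_act0 (lamt s) (kerU_pi a) = kerU_pi (alpha s a).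
Proof.
rewrite -quot_actE; apply: quot_act_lam.
by case: cid => t /= /(congr1 val).
Qed.

Fact tilde_quot_actD x : {morph tilde_quot_act0 x : a b / a + b}.
Proof.
move=> u v; have [s <-] := lamtP x.
have [a ->] := kerU_piP u; have [b ->] := kerU_piP v.
by rewrite -kerU_piD !tilde_quot_act0E eactD kerU_piD.
Qed.

Fact tilde_quot_actM x : {morph tilde_quot_act0 x : a b / a * b}.
Proof.
move=> u v; have [s <-] := lamtP x.
have [a ->] := kerU_piP u; have [b ->] := kerU_piP v.
rewrite -[_ * _]/(kerU_mul _ _) -[RHS]/(kerU_mul _ _).
by rewrite kerU_piM !tilde_quot_act0E kerU_piM eactM.
Qed.

Fact tilde_quot_act1 : tilde_quot_act0 1%g =1 id.
Proof.
move=> u; have [a ->] := kerU_piP u.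
by rewrite -lamt1 tilde_quot_act0E eact1.
Qed.

Fact tilde_quot_act_mul x y :
  tilde_quot_act0 (x * y)%g =1 tilde_quot_act0 x \o tilde_quot_act0 y.
Proof.
move=> u; have [s <-] := lamtP x; have [t <-] := lamtP y.
have [a ->] := kerU_piP u.
by rewrite -lamtM /= !tilde_quot_act0E eact_mul.
Qed.

Definition tilde_quot_act : endr_action (tilde S) kerU_quot :=
  EndrAction tilde_quot_actD tilde_quot_actM tilde_quot_act1
    tilde_quot_act_mul.

Lemma tilde_quot_actE s a :
  tilde_quot_act (lamt s) (kerU_pi a) = kerU_pi (alpha s a).
Proof. exact: tilde_quot_act0E. Qed.

Lemma tilde_quot_act_inj x : injective (tilde_quot_act x).
Proof. exact: quot_act_inj. Qed.

End UnionOfKernels.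

(* -------------------------------------------------------------------- *)
(* Data (phi, s |-> s_-, s |-> s_+) in R satisfying the relations that define
   the fractional skew monoid ring; fs_mM says that s |-> s_- is a monoid
   homomorphism on the opposite monoid of S.                              *)
Record fskew_data (S : monoidType) (A : pzRingType) (alpha : endr_action S A)
    (R : pzRingType) := FskewData {
  fs_phi : {rmorphism A -> R};
  fs_m : S -> R;
  fs_p : S -> R;
  fs_m1 : fs_m 1%g = 1;
  fs_mM : forall s t, fs_m (s * t)%g = fs_m t * fs_m s;
  fs_p1 : fs_p 1%g = 1;
  fs_pM : forall s t, fs_p (s * t)%g = fs_p s * fs_p t;
  fs_p_phi : forall s a, fs_p s * fs_phi a = fs_phi (alpha s a) * fs_p s;
  fs_phi_m : forall s a, fs_phi a * fs_m s = fs_m s * fs_phi (alpha s a);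
  fs_mp : forall s, fs_m s * fs_p s = 1;
  fs_pm : forall s, fs_p s * fs_m s = fs_phi (alpha s 1)
}.

Record fskew_compat (S : monoidType) (A : pzRingType) (alpha : endr_action S A)
    (R R' : pzRingType) (r : fskew_data alpha R) (r' : fskew_data alpha R')
    (f : R -> R') : Prop := FskewCompat {
  fs_compat_phi : forall a, f (fs_phi r a) = fs_phi r' a;
  fs_compat_m : forall s, f (fs_m r s) = fs_m r' s;
  fs_compat_p : forall s, f (fs_p r s) = fs_p r' s
}.

Definition fskew_universal (S : monoidType) (A : pzRingType)
    (alpha : endr_action S A) (R : pzRingType) (r : fskew_data alpha R) :
  Prop :=
  forall (R' : pzRingType) (r' : fskew_data alpha R'),
  exists f : {rmorphism R -> R'}, fskew_compat r r' f /\
    forall g : {rmorphism R -> R'}, fskew_compat r r' g -> g =1 f.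

(* Any model of S^op *_alpha A *_alpha S, which is only defined up to
   isomorphism; fskew_pres below is one.                                  *)
Record fskew (S : monoidType) (A : pzRingType) (alpha : endr_action S A) :=
  Fskew {
    fsk_ring :> pzRingType;
    fsk :> fskew_data alpha fsk_ring;
    fsk_universal : fskew_universal fsk
  }.

(* fpres consists of the terms in the generators modulo the congruence
   generated by the ring axioms and the defining relations.               *)
Section FskewPresentation.
Variables (S : monoidType) (A : pzRingType) (alpha : endr_action S A).

Inductive fterm :=
  | FPhi of A | FM of S | FP of S
  | FAdd of fterm & fterm | FOpp of fterm | FMul of fterm & fterm.

HB.instance Definition _ := gen_eqMixin fterm.
HB.instance Definition _ := gen_choiceMixin fterm.

Inductive fcong : fterm -> fterm -> Prop :=
  | FC_refl x : fcong x x
  | FC_sym x y : fcong x y -> fcong y x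
  | FC_trans y x z : fcong x y -> fcong y z -> fcong x z
  | FC_add x x' y y' : fcong x x' -> fcong y y' ->
      fcong (FAdd x y) (FAdd x' y')
  | FC_opp x x' : fcong x x' -> fcong (FOpp x) (FOpp x')
  | FC_mul x x' y y' : fcong x x' -> fcong y y' ->
      fcong (FMul x y) (FMul x' y')
  | FC_addA x y z : fcong (FAdd x (FAdd y z)) (FAdd (FAdd x y) z)
  | FC_addC x y : fcong (FAdd x y) (FAdd y x)
  | FC_add0 x : fcong (FAdd (FPhi 0) x) x
  | FC_addN x : fcong (FAdd (FOpp x) x) (FPhi 0)
  | FC_mulA x y z : fcong (FMul x (FMul y z)) (FMul (FMul x y) z)
  | FC_mul1 x : fcong (FMul (FPhi 1) x) x
  | FC_mulr1 x : fcong (FMul x (FPhi 1)) x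
  | FC_mulDl x y z : fcong (FMul (FAdd x y) z) (FAdd (FMul x z) (FMul y z))
  | FC_mulDr x y z : fcong (FMul x (FAdd y z)) (FAdd (FMul x y) (FMul x z))
  | FC_phiD a b : fcong (FPhi (a + b)) (FAdd (FPhi a) (FPhi b))
  | FC_phiM a b : fcong (FPhi (a * b)) (FMul (FPhi a) (FPhi b))
  | FC_m1 : fcong (FM 1%g) (FPhi 1)
  | FC_mM s t : fcong (FM (s * t)%g) (FMul (FM t) (FM s))
  | FC_p1 : fcong (FP 1%g) (FPhi 1)
  | FC_pM s t : fcong (FP (s * t)%g) (FMul (FP s) (FP t))
  | FC_p_phi s a :
      fcong (FMul (FP s) (FPhi a)) (FMul (FPhi (alpha s a)) (FP s))
  | FC_phi_m s a :
      fcong (FMul (FPhi a) (FM s)) (FMul (FM s) (FPhi (alpha s a)))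
  | FC_mp s : fcong (FMul (FM s) (FP s)) (FPhi 1)
  | FC_pm s : fcong (FMul (FP s) (FM s)) (FPhi (alpha s 1)).

Definition fcongb x y : bool := `[< fcong x y >].

Lemma fcongb_refl : reflexive fcongb.
Proof. by move=> x; apply/asboolP; apply: FC_refl. Qed.

Lemma fcongb_sym : symmetric fcongb.
Proof. by move=> x y; apply/asboolP/asboolP; apply: FC_sym. Qed.

Lemma fcongb_trans : transitive fcongb.
Proof.
by move=> y x z /asboolP xy /asboolP yz; apply/asboolP; apply: FC_trans yz.
Qed.

Definition fcong_equiv := EquivRel fcongb fcongb_refl fcongb_sym fcongb_trans.

Definition fpres := {eq_quot fcong_equiv}.
HB.instance Definition _ : EqQuotient _ fcong_equiv fpres :=
  EqQuotient.on fpres.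
HB.instance Definition _ := Choice.on fpres.

Definition fpi (x : fterm) : fpres := \pi_fpres x.

Lemma fpiE x y : fpi x = fpi y <-> fcong x y.
Proof.
by split=> [/eqmodP/asboolP|h] //; apply/eqmodP; apply/asboolP.
Qed.

Lemma frepr x : fcong (repr (fpi x)) x.
Proof. by apply/fpiE; rewrite /fpi reprK. Qed.

Lemma fpiP (x : fpres) : exists t, x = fpi t.
Proof. by elim/quotW: x => t; exists t. Qed.

Definition fadd (x y : fpres) := fpi (FAdd (repr x) (repr y)).
Definition fopp (x : fpres) := fpi (FOpp (repr x)).
Definition fmul (x y : fpres) := fpi (FMul (repr x) (repr y)).

Lemma faddE x y : fadd (fpi x) (fpi y) = fpi (FAdd x y).
Proof. by apply/fpiE; apply: FC_add; apply: frepr. Qed.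

Lemma foppE x : fopp (fpi x) = fpi (FOpp x).
Proof. by apply/fpiE; apply: FC_opp; apply: frepr. Qed.

Lemma fmulE x y : fmul (fpi x) (fpi y) = fpi (FMul x y).
Proof. by apply/fpiE; apply: FC_mul; apply: frepr. Qed.

Let fE := (faddE, foppE, fmulE).

Lemma faddA : associative fadd.
Proof.
move=> x y z; have [a ->] := fpiP x.
have [b ->] := fpiP y; have [c ->] := fpiP z.
by rewrite !fE; apply/fpiE; apply: FC_addA.
Qed.

Lemma faddC : commutative fadd.
Proof.
move=> x y; have [a ->] := fpiP x; have [b ->] := fpiP y.
by rewrite !fE; apply/fpiE; apply: FC_addC.
Qed.

Lemma fadd0 : left_id (fpi (FPhi 0)) fadd.
Proof.
by move=> x; have [a ->] := fpiP x; rewrite !fE; apply/fpiE; apply: FC_add0.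
Qed.

Lemma faddN : left_inverse (fpi (FPhi 0)) fopp fadd.
Proof.
by move=> x; have [a ->] := fpiP x; rewrite !fE; apply/fpiE; apply: FC_addN.
Qed.

HB.instance Definition _ := GRing.isZmodule.Build fpres faddA faddC fadd0 faddN.

Lemma fmulA : associative fmul.
Proof.
move=> x y z; have [a ->] := fpiP x.
have [b ->] := fpiP y; have [c ->] := fpiP z.
by rewrite !fE; apply/fpiE; apply: FC_mulA.
Qed.

Lemma fmul1 : left_id (fpi (FPhi 1)) fmul.
Proof.
by move=> x; have [a ->] := fpiP x; rewrite !fE; apply/fpiE; apply: FC_mul1.
Qed.

Lemma fmulr1 : right_id (fpi (FPhi 1)) fmul.
Proof.
by move=> x; have [a ->] := fpiP x; rewrite !fE; apply/fpiE; apply: FC_mulr1.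
Qed.

Lemma fmulDl : left_distributive fmul +%R.
Proof.
move=> x y z; have [a ->] := fpiP x.
have [b ->] := fpiP y; have [c ->] := fpiP z.
rewrite -[_ + _]/(fadd _ _) -[RHS]/(fadd _ _).
by rewrite !fE; apply/fpiE; apply: FC_mulDl.
Qed.

Lemma fmulDr : right_distributive fmul +%R.
Proof.
move=> x y z; have [a ->] := fpiP x.
have [b ->] := fpiP y; have [c ->] := fpiP z.
rewrite -[_ + _]/(fadd _ _) -[RHS]/(fadd _ _).
by rewrite !fE; apply/fpiE; apply: FC_mulDr.
Qed.

HB.instance Definition _ :=
  GRing.Zmodule_isPzRing.Build fpres fmulA fmul1 fmulr1 fmulDl fmulDr.

Lemma fpiD x y : fpi (FAdd x y) = fpi x + fpi y.
Proof. by rewrite -faddE. Qed.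

Lemma fpiN x : fpi (FOpp x) = - fpi x.
Proof. by rewrite -foppE. Qed.

Lemma fpiM x y : fpi (FMul x y) = fpi x * fpi y.
Proof. by rewrite -fmulE. Qed.

Definition fphi (a : A) : fpres := fpi (FPhi a).

Lemma fphiD : {morph fphi : a b / a + b}.
Proof. by move=> a b; rewrite -fpiD; apply/fpiE; apply: FC_phiD. Qed.

Lemma fphi_zmod_morphism : zmod_morphism fphi.
Proof.
by move=> a b; apply: (addIr (fphi b)); rewrite -fphiD !subrK.
Qed.

Lemma fphi_monoid_morphism : GRing.monoid_morphism fphi.
Proof.
by split=> // a b; rewrite -fpiM; apply/fpiE; apply: FC_phiM.
Qed.

HB.instance Definition _ :=
  GRing.isZmodMorphism.Build A fpres fphi fphi_zmod_morphism.
HB.instance Definition _ :=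
  GRing.isMonoidMorphism.Build A fpres fphi fphi_monoid_morphism.

Definition fpres_data : fskew_data alpha fpres.
Proof.
refine (@FskewData S A alpha fpres fphi (fun s => fpi (FM s))
          (fun s => fpi (FP s)) _ _ _ _ _ _ _ _).
- by apply/fpiE; apply: FC_m1.
- by move=> s t; rewrite -fpiM; apply/fpiE; apply: FC_mM.
- by apply/fpiE; apply: FC_p1.
- by move=> s t; rewrite -fpiM; apply/fpiE; apply: FC_pM.
- by move=> s a; rewrite -!fpiM; apply/fpiE; apply: FC_p_phi.
- by move=> s a; rewrite -!fpiM; apply/fpiE; apply: FC_phi_m.
- by move=> s; rewrite -fpiM; apply/fpiE; apply: FC_mp.
- by move=> s; rewrite -fpiM; apply/fpiE; apply: FC_pm.
Defined.

Fixpoint feval (R : pzRingType) (r : fskew_data alpha R) (x : fterm) : R :=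
  match x with
  | FPhi a => fs_phi r a
  | FM s => fs_m r s
  | FP s => fs_p r s
  | FAdd x y => feval r x + feval r y
  | FOpp x => - feval r x
  | FMul x y => feval r x * feval r y
  end.

Lemma feval_cong (R : pzRingType) (r : fskew_data alpha R) x y :
  fcong x y -> feval r x = feval r y.
Proof.
elim=> //=.
- by move=> ? ? ? _ -> _ ->.
- by move=> ? ? ? ? _ -> _ ->.
- by move=> ? ? _ ->.
- by move=> ? ? ? ? _ -> _ ->.
- by move=> *; rewrite addrA.
- by move=> *; rewrite addrC.
- by move=> *; rewrite rmorph0 add0r.
- by move=> *; rewrite rmorph0 addNr.
- by move=> *; rewrite mulrA.
- by move=> *; rewrite rmorph1 mul1r.
- by move=> *; rewrite rmorph1 mulr1.
- by move=> *; rewrite mulrDl.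
- by move=> *; rewrite mulrDr.
- by move=> *; rewrite rmorphD.
- by move=> *; rewrite rmorphM.
- by rewrite rmorph1 fs_m1.
- by move=> *; rewrite fs_mM.
- by rewrite rmorph1 fs_p1.
- by move=> *; rewrite fs_pM.
- by move=> *; rewrite fs_p_phi.
- by move=> *; rewrite fs_phi_m.
- by move=> *; rewrite fs_mp rmorph1.
- by move=> *; rewrite fs_pm.
Qed.

Lemma fpres_universal : fskew_universal fpres_data.
Proof.
move=> R r; pose f (x : fpres) := feval r (repr x).
have fE' x : f (fpi x) = feval r x by apply: feval_cong; apply: frepr.
have fB : zmod_morphism f.
  move=> x y; have [a ->] := fpiP x; have [b ->] := fpiP y.
  by rewrite -fpiN -fpiD !fE'.
have fM : GRing.monoid_morphism f.
  split=> [|x y]; first by rewrite -[1]/(fpi (FPhi 1)) fE' /= rmorph1.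
  have [a ->] := fpiP x; have [b ->] := fpiP y.
  by rewrite -fpiM !fE'.
pose m1 := GRing.isZmodMorphism.Build fpres R f fB.
pose m2 := GRing.isMonoidMorphism.Build fpres R f fM.
pose F : {rmorphism fpres -> R} := HB.pack f m1 m2.
exists F; split; first by split=> *; rewrite /= fE'.
move=> g [g_phi g_m g_p] x; have [t ->] := fpiP x; rewrite [RHS]fE'.
elim: t => [a|s|s|u IHu v IHv|u IHu|u IHu v IHv].
- exact: g_phi.
- exact: g_m.
- exact: g_p.
- by rewrite fpiD rmorphD IHu IHv.
- by rewrite fpiN rmorphN IHu.
- by rewrite fpiM rmorphM IHu IHv.
Qed.

Definition fskew_pres : fskew alpha := Fskew fpres_universal.

End FskewPresentation.

(* -------------------------------------------------------------------- *)
(* SAS is the subring S_- A S_+ of R, and SAS_act its action x |-> t_+ x t_-. *)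
Section MinusPlus.
Variables (S : revOreMonoidType) (A : pzRingType) (alpha : endr_action S A).
Variables (R : pzRingType) (r : fskew_data alpha R).
Local Notation phi := (fs_phi r).
Local Notation m := (fs_m r).
Local Notation p := (fs_p r).

Definition SAS_pred : pred R :=
  fun x => `[< exists s a, x = m s * phi a * p s >].

Lemma SAS_predP x :
  reflect (exists s a, x = m s * phi a * p s) (x \in SAS_pred).
Proof. exact: asboolP. Qed.

Lemma SAS_expand t s a :
  m s * phi a * p s = m (t * s)%g * phi (alpha t a) * p (t * s)%g.
Proof.
rewrite fs_mM fs_pM !mulrA -[m s * m t * _]mulrA -fs_phi_m.
by rewrite -!mulrA [m t * _]mulrA fs_mp mul1r.
Qed.

Lemma SAS_subring_closed : subring_closed SAS_pred.
Proof.
have common x y : x \in SAS_pred -> y \in SAS_pred -> exists s a b,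
    x = m s * phi a * p s /\ y = m s * phi b * p s.
  move=> /SAS_predP[s [a ->]] /SAS_predP[t [b ->]].
  have [s' [t' e]] := oreP s t.
  exists (s' * t)%g, (alpha t' a), (alpha s' b).
  by rewrite {1 2}e -!SAS_expand.
split=> [|x y Sx Sy|x y Sx Sy].
- by apply/SAS_predP; exists 1%g, 1; rewrite fs_m1 fs_p1 rmorph1 !mulr1.
- have [s [a [b [-> ->]]]] := common _ _ Sx Sy; apply/SAS_predP.
  by exists s, (a - b); rewrite rmorphB mulrBr mulrBl.
have [s [a [b [-> ->]]]] := common _ _ Sx Sy; apply/SAS_predP.
exists s, (a * alpha s 1 * b); rewrite !rmorphM -fs_pm.
by rewrite !mulrA.
Qed.

Record SAS := MkSAS {SAS_val : R; SAS_valP : SAS_val \in SAS_pred}.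

HB.instance Definition _ := [isSub for SAS_val].
HB.instance Definition _ := [Choice of SAS by <:].
HB.instance Definition _ :=
  GRing.SubChoice_isSubPzRing.Build R SAS_pred SAS SAS_subring_closed.

Lemma SAS_phi_subproof a : phi a \in SAS_pred.
Proof. by apply/SAS_predP; exists 1%g, a; rewrite fs_m1 fs_p1 mulr1 mul1r. Qed.

Definition SAS_phi (a : A) : SAS := MkSAS (SAS_phi_subproof a).

Lemma SAS_act_subproof t (x : SAS) : p t * SAS_val x * m t \in SAS_pred.
Proof.
case: x => _ /= /SAS_predP[s [a ->]]; have [s' [t' e]] := oreP s t.
have ts : p t * m s = m s' * phi (alpha t' (alpha s 1)) * p t'.
  rewrite -mulrA -fs_p_phi -fs_pm 2!mulrA -[_ * p t' * p s]mulrA -fs_pM -e.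
  by rewrite fs_pM !mulrA fs_mp mul1r.
have st : p s * m t = m t' * phi (alpha t' (alpha s 1)) * p s'.
  rewrite -fs_phi_m -fs_pm -!mulrA [m s * _]mulrA -fs_mM -e.
  by rewrite fs_mM -!mulrA fs_mp mulr1.
apply/SAS_predP; set q := alpha t' (alpha s 1) in ts st *.
exists s', (q * alpha t' a * alpha t' 1 * q).
rewrite !rmorphM -fs_pm !mulrA ts -[LHS]mulrA st.
by rewrite !mulrA -[_ * p t' * phi a]mulrA fs_p_phi !mulrA.
Qed.

Definition SAS_act0 (t : S) (x : SAS) : SAS := MkSAS (SAS_act_subproof t x).

Fact SAS_actD t : {morph SAS_act0 t : x y / x + y}.
Proof. by move=> x y; apply: val_inj; rewrite /= mulrDr mulrDl. Qed.

Fact SAS_actM t : {morph SAS_act0 t : x y / x * y}.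
Proof.
move=> x y; apply: val_inj => /=.
by rewrite !mulrA -[_ * m t * p t]mulrA fs_mp mulr1.
Qed.

Fact SAS_act1 : SAS_act0 1%g =1 id.
Proof. by move=> x; apply: val_inj; rewrite /= fs_m1 fs_p1 mul1r mulr1. Qed.

Fact SAS_act_mul s t : SAS_act0 (s * t)%g =1 SAS_act0 s \o SAS_act0 t.
Proof. by move=> x; apply: val_inj; rewrite /= fs_pM fs_mM !mulrA. Qed.

Definition SAS_act : endr_action S SAS :=
  EndrAction SAS_actD SAS_actM SAS_act1 SAS_act_mul.

Lemma SAS_act_inj t : injective (SAS_act t).
Proof.
have K x : m t * (p t * x * m t) * p t = x.
  by rewrite !mulrA fs_mp mul1r -mulrA fs_mp mulr1.
move=> x y /(congr1 SAS_val) /= /(congr1 (fun z => m t * z * p t)).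
by rewrite !K => e; apply: val_inj.
Qed.

End MinusPlus.

(* -------------------------------------------------------------------- *)
(* Associative rings that need not have a unit; the library has none.     *)
HB.mixin Record Zmodule_isRng C of GRing.Zmodule C := {
  rmul : C -> C -> C;
  rmulA : associative rmul;
  rmulDl : left_distributive rmul +%R;
  rmulDr : right_distributive rmul +%R
}.

#[short(type="rngType")]
HB.structure Definition Rng := {C of GRing.Zmodule C & Zmodule_isRng C}.

Notation "x ** y" := (rmul x y) (at level 40, left associativity) : ring_scope.

Section RngTheory.
Variable C : rngType.
Implicit Types x y z : C.

Lemma rmul0r : left_zero 0 (@rmul C).
Proof. by move=> x; apply: (addrI (0 ** x)); rewrite -rmulDl !addr0. Qed.

Lemma rmulr0 : right_zero 0 (@rmul C).
Proof. by move=> x; apply: (addrI (x ** 0)); rewrite -rmulDr !addr0. Qed.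

Definition rng_idempotent x : Prop := x ** x = x.

Definition idem_le x y : Prop := x = x ** y /\ x = y ** x.

Definition corner x : C -> Prop := fun z => exists y, z = x ** y ** x.

End RngTheory.

(* -------------------------------------------------------------------- *)
(* Each aact g is bijective, see aact_bij below.                          *)
Record aut_action (G : groupType) (C : rngType) := AutAction {
  aact :> G -> C -> C;
  aactD : forall g, {morph aact g : x y / x + y};
  aactM : forall g, {morph aact g : x y / x ** y};
  aact1 : aact 1%g =1 id;
  aact_mul : forall g h, aact (g * h)%g =1 aact g \o aact h
}.

Section AutActionTheory.
Variables (G : groupType) (C : rngType) (ah : aut_action G C).

Lemma aact_bij g : bijective (ah g).
Proof.
exists (ah g^-1%g) => x; rewrite -[LHS]/((_ \o _) x) -aact_mul.
  by rewrite mulVg aact1.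
by rewrite mulgV aact1.
Qed.

Lemma aact0 g : ah g 0 = 0.
Proof. by apply: (addrI (ah g 0)); rewrite -aactD !addr0. Qed.

End AutActionTheory.

(* -------------------------------------------------------------------- *)
(* S^-1 B: the pair (s, b) stands for s^-1 b. Neither the action nor the left
   reversible monoid S has to be injective, resp. cancellative, for the sum and
   the product to be well defined. The result has no unit in general.     *)
Section Localization.
Variables (S : revOreMonoidType) (B : pzRingType) (beta : endr_action S B).
Implicit Types (s t u : S) (b c : B) (x y : S * B).

Definition loc_rel x y : bool :=
  `[< exists t1 t2, (t1 * x.1 = t2 * y.1)%g /\ beta t1 x.2 = beta t2 y.2 >].

Lemma loc_rel_refl : reflexive loc_rel.
Proof. by move=> x; apply/asboolP; exists 1%g, 1%g. Qed.

Lemma loc_rel_sym : symmetric loc_rel.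
Proof.
by move=> x y; apply/asboolP/asboolP => -[u [v [e1 e2]]]; exists v, u.
Qed.

Lemma loc_rel_trans : transitive loc_rel.
Proof.
move=> y x z /asboolP[u [v [e1 e2]]] /asboolP[u' [v' [e1' e2']]].
have [w [w' ew]] := oreP u' v; apply/asboolP.
exists (w * u)%g, (w' * v')%g; split.
  by rewrite -!mulgA e1 -e1' !mulgA ew.
by rewrite !eact_mul /= e2 -e2' -[LHS]eact_mul ew eact_mul.
Qed.

Definition loc_equiv :=
  EquivRel loc_rel loc_rel_refl loc_rel_sym loc_rel_trans.

Definition loc := {eq_quot loc_equiv}.
HB.instance Definition _ : EqQuotient _ loc_equiv loc := EqQuotient.on loc.
HB.instance Definition _ := Choice.on loc.

Definition mkloc s b : loc := \pi_loc (s, b).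

Lemma mkloc_eq s b s' b' : mkloc s b = mkloc s' b' <->
  exists t1 t2, (t1 * s = t2 * s')%g /\ beta t1 b = beta t2 b'.
Proof.
split; first by move/eqmodP/asboolP.
by move=> h; apply/eqmodP/asboolP.
Qed.

Lemma mkloc_expand t s b : mkloc s b = mkloc (t * s)%g (beta t b).
Proof. by apply/mkloc_eq; exists t, 1%g; rewrite mul1g eact1. Qed.

Lemma locP (x : loc) : exists s b, x = mkloc s b.
Proof. by elim/quotW: x => -[s b]; exists s, b. Qed.

Section BinOp.
Variable op : B -> B -> B.
Hypothesis opM : forall t, {morph beta t : b c / op b c}.

Definition loc_op0 x y : loc :=
  let p := ore_pair y.1 x.1 in
  mkloc (p.1 * x.1)%g (op (beta p.1 x.2) (beta p.2 y.2)).

Lemma loc_op0E s b s' b' t1 t2 : (t1 * s = t2 * s')%g ->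
  loc_op0 (s, b) (s', b') = mkloc (t1 * s)%g (op (beta t1 b) (beta t2 b')).
Proof.
rewrite /loc_op0 /=; set r := ore_pair _ _; have := ore_pairP s' s.
rewrite -/r; move: r.1 r.2 => u1 u2 {r} e' e.
have [w [w' ew]] := oreP (t1 * s)%g (u1 * s)%g.
have /revP[v1 ev1] : ((w * u1) * s = (w' * t1) * s)%g by rewrite -!mulgA.
have /revP[v2 ev2] : ((v1 * w * u2) * s' = (v1 * w' * t2) * s')%g.
  by rewrite -!mulgA -e -e' ew.
apply/mkloc_eq; exists (v2 * v1 * w)%g, (v2 * v1 * w')%g; split.
  by rewrite -!mulgA ew.
rewrite !opM -![beta (_ * _)%g _]/(beta _ _).
rewrite -![beta (_ * _)%g (beta _ _)]eact_mul.
congr op; last by rewrite -!mulgA in ev2 *; rewrite ev2.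
by rewrite -!mulgA in ev1 *; rewrite ev1.
Qed.

Definition loc_op (x y : loc) : loc := loc_op0 (repr x) (repr y).

Lemma loc_opE s b s' b' t1 t2 : (t1 * s = t2 * s')%g ->
  loc_op (mkloc s b) (mkloc s' b')
  = mkloc (t1 * s)%g (op (beta t1 b) (beta t2 b')).
Proof.
rewrite /loc_op /mkloc; case: piP => -[a c] /mkloc_eq[u [v [e1 e2]]].
case: piP => -[a' c'] /mkloc_eq[u' [v' [e1' e2']]] e.
have [w [x ew]] := oreP (v' * a')%g (v * a)%g.
rewrite (@loc_op0E _ _ _ _ (w * v)%g (x * v')%g); last by rewrite -!mulgA.
rewrite !eact_mul /= -e2 -e2' -![beta _ (beta _ _)]eact_mul -!mulgA -e1 !mulgA.
rewrite -(@loc_op0E s b s' b'); first exact: loc_op0E.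
by rewrite -!mulgA e1 e1' ew.
Qed.

Lemma loc_op_same s b c : loc_op (mkloc s b) (mkloc s c) = mkloc s (op b c).
Proof. by rewrite (@loc_opE _ _ _ _ 1%g 1%g) // mul1g !eact1. Qed.

End BinOp.

Lemma loc_common x y : exists s b c,
  mkloc x.1 x.2 = mkloc s b /\ mkloc y.1 y.2 = mkloc s c.
Proof.
have [t1 [t2 e]] := oreP y.1 x.1.
exists (t1 * x.1)%g, (beta t1 x.2), (beta t2 y.2).
by split; [|rewrite e]; apply: mkloc_expand.
Qed.

Lemma loc_common2 (x y : loc) : exists s b c, x = mkloc s b /\ y = mkloc s c.
Proof.
have [s [b ->]] := locP x; have [t [c ->]] := locP y.
exact: (loc_common (s, b) (t, c)).
Qed.

Lemma loc_common3 (x y z : loc) : exists s b c d,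
  [/\ x = mkloc s b, y = mkloc s c & z = mkloc s d].
Proof.
have [s [b [c [-> ->]]]] := loc_common2 x y; have [t [d ->]] := locP z.
have [t1 [t2 e]] := oreP t s.
exists (t1 * s)%g, (beta t1 b), (beta t1 c), (beta t2 d).
by split; [| |rewrite e]; apply: mkloc_expand.
Qed.

Definition loc_add := loc_op +%R.
Definition loc_mul := loc_op *%R.
Definition loc_zero : loc := mkloc 1%g 0.
Definition loc_opp (x : loc) : loc := mkloc (repr x).1 (- (repr x).2).

Lemma loc_zeroE s : loc_zero = mkloc s 0.
Proof. by rewrite /loc_zero (mkloc_expand s) mulg1 eact0. Qed.

Lemma loc_oppE s b : loc_opp (mkloc s b) = mkloc s (- b).
Proof.
rewrite /loc_opp /mkloc; case: piP => -[t c] /mkloc_eq[u [v [e1 e2]]] /=.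
by apply/mkloc_eq; exists v, u; rewrite !eactN e1 e2.
Qed.

Let addE s b c : loc_add (mkloc s b) (mkloc s c) = mkloc s (b + c).
Proof. by apply: loc_op_same => t; apply: eactD. Qed.

Let mulE s b c : loc_mul (mkloc s b) (mkloc s c) = mkloc s (b * c).
Proof. by apply: loc_op_same => t; apply: eactM. Qed.

Lemma loc_addA : associative loc_add.
Proof.
move=> x y z; have [s [b [c [d [-> -> ->]]]]] := loc_common3 x y z.
by rewrite !addE addrA.
Qed.

Lemma loc_addC : commutative loc_add.
Proof.
move=> x y; have [s [b [c [-> ->]]]] := loc_common2 x y.
by rewrite !addE addrC.
Qed.

Lemma loc_add0 : left_id loc_zero loc_add.
Proof.
by move=> x; have [s [b ->]] := locP x; rewrite (loc_zeroE s) addE add0r.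
Qed.

Lemma loc_addN : left_inverse loc_zero loc_opp loc_add.
Proof.
move=> x; have [s [b ->]] := locP x.
by rewrite loc_oppE addE addNr (loc_zeroE s).
Qed.

HB.instance Definition _ :=
  GRing.isZmodule.Build loc loc_addA loc_addC loc_add0 loc_addN.

Lemma loc_mulA : associative loc_mul.
Proof.
move=> x y z; have [s [b [c [d [-> -> ->]]]]] := loc_common3 x y z.
by rewrite !mulE mulrA.
Qed.

Lemma loc_mulDl : left_distributive loc_mul +%R.
Proof.
move=> x y z; have [s [b [c [d [-> -> ->]]]]] := loc_common3 x y z.
rewrite -[_ + _]/(loc_add _ _) -[RHS]/(loc_add _ _).
by rewrite !(mulE, addE) mulrDl.
Qed.

Lemma loc_mulDr : right_distributive loc_mul +%R.
Proof.
move=> x y z; have [s [b [c [d [-> -> ->]]]]] := loc_common3 x y z.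
rewrite -[_ + _]/(loc_add _ _) -[RHS]/(loc_add _ _).
by rewrite !(mulE, addE) mulrDr.
Qed.

HB.instance Definition _ :=
  Zmodule_isRng.Build loc loc_mulA loc_mulDl loc_mulDr.

Lemma mklocD s1 b1 s2 b2 t1 t2 : (t1 * s1 = t2 * s2)%g ->
  mkloc s1 b1 + mkloc s2 b2 = mkloc (t1 * s1)%g (beta t1 b1 + beta t2 b2).
Proof. by move=> e; apply: loc_opE e => t; apply: eactD. Qed.

Lemma mklocM s1 b1 s2 b2 t1 t2 : (t1 * s1 = t2 * s2)%g ->
  mkloc s1 b1 ** mkloc s2 b2 = mkloc (t1 * s1)%g (beta t1 b1 * beta t2 b2).
Proof. by move=> e; apply: loc_opE e => t; apply: eactM. Qed.

End Localization.

(* -------------------------------------------------------------------- *)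
(* The skew group ring C *_ah G: finitely supported functions G -> C, with
   << c *g g >> standing for c g.                                         *)
Section SkewGroupRing.
Variables (G : groupType) (C : rngType) (ah : aut_action G C).
Implicit Types (c d : C) (g h k : G).

Definition skew_ring : Type := let _ := ah in {malg C[G]}.
HB.instance Definition _ := GRing.Zmodule.on skew_ring.
Implicit Types (x y z : skew_ring).

Definition skew_mono c g : skew_ring := << c *g g >>.

Lemma skew_monoD g : {morph skew_mono^~ g : c d / c + d}.
Proof. by move=> c d; apply: monalgUD. Qed.

Lemma skew_mono0 g : skew_mono 0 g = 0.
Proof. exact: monalgU0. Qed.

Lemma skewE x : x = \sum_(g <- msupp x) skew_mono x@_g g.
Proof. exact: monalgE. Qed.

Lemma skew_ind (P : skew_ring -> Prop) : P 0 ->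
  (forall x y, P x -> P y -> P (x + y)) ->
  (forall c g, P (skew_mono c g)) -> forall x, P x.
Proof. by move=> P0 PD Pm x; rewrite [x]skewE; apply: big_ind. Qed.

Definition skew_mul x y : skew_ring :=
  \sum_(g <- msupp x) \sum_(h <- msupp y)
    skew_mono (x@_g ** ah g y@_h) (g * h)%g.

Lemma skew_extD (V : zmodType) (f : C -> G -> V) :
  (forall g, {morph f^~ g : c d / c + d}) ->
  {morph (fun x : skew_ring => \sum_(g <- msupp x) f x@_g g) : x y / x + y}.
Proof.
move=> fD; have f0 g : f 0 g = 0.
  by apply: (addrI (f 0 g)); rewrite -fD !addr0.
have ext (D : {fset G}) x : (msupp x `<=` D)%fset ->
    \sum_(g <- msupp x) f x@_g g = \sum_(g <- D) f x@_g g.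
  move=> sD; apply: big_fset_incl => // g _ /mcoeff_outdom ->.
  exact: f0.
move=> x y /=; set D := (msupp x `|` msupp y)%fset.
rewrite (ext D (x + y)); last exact: msuppD_le.
rewrite (ext D x) ?fsubsetUl // (ext D y) ?fsubsetUr // -big_split /=.
by apply: eq_bigr => g _; rewrite mcoeffD fD.
Qed.

Lemma skew_ext_mono (V : zmodType) (f : C -> G -> V) c g :
  (forall g, {morph f^~ g : c d / c + d}) ->
  \sum_(h <- msupp (skew_mono c g)) f (skew_mono c g)@_h h = f c g.
Proof.
move=> fD; have f0 h : f 0 h = 0.
  by apply: (addrI (f 0 h)); rewrite -fD !addr0.
rewrite msuppU; case: eqP => [->|_]; first by rewrite big_seq_fset0 f0.
by rewrite big_seq_fset1 mcoeffUU.
Qed.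

Lemma skew_mulDr : right_distributive skew_mul +%R.
Proof.
move=> x y z; rewrite /skew_mul -big_split /=; apply: eq_bigr => g _.
apply: (skew_extD (f := fun c h => skew_mono (x@_g ** ah g c) (g * h)%g)).
by move=> h c d; rewrite aactD rmulDr skew_monoD.
Qed.

Lemma skew_mulDl : left_distributive skew_mul +%R.
Proof.
move=> x y z.
apply: (skew_extD (f := fun c g =>
  \sum_(h <- msupp z) skew_mono (c ** ah g z@_h) (g * h)%g)).
move=> g c d; rewrite -big_split; apply: eq_bigr => h _ /=.
by rewrite rmulDl skew_monoD.
Qed.

Lemma skew_mul_mono c g d h :
  skew_mul (skew_mono c g) (skew_mono d h) = skew_mono (c ** ah g d) (g * h)%g.
Proof.
rewrite /skew_mul (skew_ext_mono (f := fun c g => \sum_(h' <- _)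
  skew_mono (c ** ah g (skew_mono d h)@_h') (g * h')%g)).
  apply: (skew_ext_mono (f := fun d h => skew_mono (c ** ah g d) (g * h)%g)).
  by move=> k a b; rewrite aactD rmulDr skew_monoD.
move=> k a b; rewrite -big_split; apply: eq_bigr => l _ /=.
by rewrite rmulDl skew_monoD.
Qed.

Lemma skew_mul0 x : skew_mul 0 x = 0.
Proof. by apply: (addrI (skew_mul 0 x)); rewrite -skew_mulDl !addr0. Qed.

Lemma skew_mulr0 x : skew_mul x 0 = 0.
Proof. by apply: (addrI (skew_mul x 0)); rewrite -skew_mulDr !addr0. Qed.

Lemma skew_mulA : associative skew_mul.
Proof.
move=> x y z; elim/skew_ind: x => [|x x' IH IH'|c g].
- by rewrite !skew_mul0.
- by rewrite !skew_mulDl IH IH'.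
elim/skew_ind: y => [|y y' IH IH'|d h].
- by rewrite skew_mul0 skew_mulr0 skew_mul0.
- by rewrite !(skew_mulDl, skew_mulDr) IH IH'.
elim/skew_ind: z => [|z z' IH IH'|e k].
- by rewrite !skew_mulr0.
- by rewrite !skew_mulDr IH IH'.
by rewrite !skew_mul_mono aactM aact_mul rmulA mulgA.
Qed.

HB.instance Definition _ :=
  Zmodule_isRng.Build skew_ring skew_mulA skew_mulDl skew_mulDr.

Lemma skew_monoM c g d h :
  skew_mono c g ** skew_mono d h = skew_mono (c ** ah g d) (g * h)%g.
Proof. exact: skew_mul_mono. Qed.

Definition skew_const c : skew_ring := skew_mono c 1%g.

(* g x g^-1; g itself need not be an element of C *_ah G.                 *)
Definition skew_conj g x : skew_ring :=
  \sum_(h <- msupp x) skew_mono (ah g x@_h) (g * h * g^-1)%g.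

Lemma skew_conjD g : {morph skew_conj g : x y / x + y}.
Proof.
apply: (skew_extD (f := fun c h => skew_mono (ah g c) (g * h * g^-1)%g)).
by move=> h c d; rewrite aactD skew_monoD.
Qed.

Lemma skew_conj_mono g c h :
  skew_conj g (skew_mono c h) = skew_mono (ah g c) (g * h * g^-1)%g.
Proof.
apply: (skew_ext_mono (f := fun c h => skew_mono (ah g c) (g * h * g^-1)%g)).
by move=> k a b; rewrite aactD skew_monoD.
Qed.

End SkewGroupRing.

(* Main.v *)
(* If a group G acts on a rng C by automorphisms, k : N -> G is a monoid
   morphism and psi : A -> C is a (non-unital) ring morphism with
   k s . psi a = psi (alpha s a), then e = psi 1 is idempotent,
   k s . e = psi (alpha s 1) <= e, and
     a |-> psi a,   s_- |-> e k(s)^-1,   s_+ |-> (k s . e) k(s)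
   satisfy in the corner e (C * G) e the relations defining the fractional skew
   monoid ring. For C = S~^-1 B, the group of left fractions acts by
   g . [u, b] = [v, beta_w b] for any v, w in S~ with v^-1 w = g u^-1. Taking B
   to be the ring S~_- (A/I) S~_+ gives Phi. That e is nonzero follows by taking
   B = A/I, which also shows that S~^op * (A/I) * S~ is nonzero. *)
Require Import Defs.
From HB Require Import structures.
From mathcomp Require Import all_boot all_algebra.
From mathcomp Require Import boolp finmap monalg.

Set Implicit Arguments.
Unset Strict Implicit.
Unset Printing Implicit Defensive.

Import GRing.Theory.

Local Open Scope ring_scope.

(** * Corners as unital rings *)

Lemma rmulrN (C : rngType) (x y : C) : x ** - y = - (x ** y).
Proof. by apply: (addrI (x ** y)); rewrite -rmulDr !subrr rmulr0. Qed.

Lemma rmulNr (C : rngType) (x y : C) : - x ** y = - (x ** y).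
Proof. by apply: (addrI (x ** y)); rewrite -rmulDl !subrr rmul0r. Qed.

(* Bundled, so that the proof of idempotence is available to the canonical ring
   structure on the corner. *)
Record idem (C : rngType) := Idem {
  idem_val :> C;
  idemP : rng_idempotent idem_val
}.

Section CornerRing.
Variables (C : rngType) (e : idem C).

(** Phrased by fixed-point equations rather than as an image, so that closure is equational. They
    make [e] a unit, and the corner can then be the target of a universal property for unital
    rings. *)
Definition corner_pred : pred C := fun x => (e ** x == x) && (x ** e == x).

Lemma corner_predP x :
  reflect (e ** x = x /\ x ** e = x) (x \in corner_pred).
Proof. by apply: (iffP andP) => -[/eqP ? /eqP ?]. Qed.

Lemma corner_zmod_closed : zmod_closed corner_pred.
Proof.
split; first by apply/corner_predP; rewrite rmul0r rmulr0.
move=> x y /corner_predP[ex xe] /corner_predP[ey ye]; apply/corner_predP.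
by rewrite rmulDl rmulDr rmulrN rmulNr ex xe ey ye.
Qed.

Record corner_ring := CornerRing {
  corner_val : C;
  corner_valP : corner_val \in corner_pred
}.

HB.instance Definition _ := [isSub for corner_val].
HB.instance Definition _ := [Choice of corner_ring by <:].
HB.instance Definition _ := GRing.SubChoice_isSubZmodule.Build C corner_pred
  corner_ring corner_zmod_closed.

Lemma corner_mul_subproof (x y : corner_ring) :
  corner_val x ** corner_val y \in corner_pred.
Proof.
have /corner_predP[ex _] := corner_valP x.
have /corner_predP[_ ye] := corner_valP y.
by apply/corner_predP; rewrite rmulA ex -rmulA ye.
Qed.

Definition corner_mul x y := CornerRing (corner_mul_subproof x y).

Lemma corner_one_subproof : (e : C) \in corner_pred.
Proof. by apply/corner_predP; rewrite idemP. Qed.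

Definition corner_one := CornerRing corner_one_subproof.

Lemma corner_mulA : associative corner_mul.
Proof. by move=> x y z; apply: val_inj; rewrite /= rmulA. Qed.

Lemma corner_mul1 : left_id corner_one corner_mul.
Proof. by move=> [x xP]; apply: val_inj; case/corner_predP: (xP). Qed.

Lemma corner_mulr1 : right_id corner_one corner_mul.
Proof. by move=> [x xP]; apply: val_inj; case/corner_predP: (xP). Qed.

Lemma corner_mulDl : left_distributive corner_mul +%R.
Proof. by move=> x y z; apply: val_inj; rewrite /= rmulDl. Qed.

Lemma corner_mulDr : right_distributive corner_mul +%R.
Proof. by move=> x y z; apply: val_inj; rewrite /= rmulDr. Qed.

HB.instance Definition _ := GRing.Zmodule_isPzRing.Build corner_ring
  corner_mulA corner_mul1 corner_mulr1 corner_mulDl corner_mulDr.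

End CornerRing.

(** * The defining relations in a corner of a skew group ring *)

Section Dilation.
Variables (N : monoidType) (A : pzRingType) (alpha : endr_action N A).
Variables (G : groupType) (C : rngType) (ah : aut_action G C).
Variables (k : N -> G) (psi : A -> C).
Hypotheses (k1 : k 1%g = 1%g) (kM : {morph k : s t / (s * t)%g}).
Hypotheses (psiD : {morph psi : a b / a + b}).
Hypotheses (psiM : {morph psi : a b / a * b >-> a ** b}).
Hypothesis psi_act : forall s a, ah (k s) (psi a) = psi (alpha s a).

Let e := psi 1.

Lemma dilation_idem : rng_idempotent e.
Proof. by rewrite /rng_idempotent -psiM mulr1. Qed.

Let epsi a : e ** psi a = psi a. Proof. by rewrite -psiM mul1r. Qed.
Let psie a : psi a ** e = psi a. Proof. by rewrite -psiM mulr1. Qed.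

Lemma dilation_act_le s : idem_le (ah (k s) e) e.
Proof. by rewrite /idem_le /e psi_act epsi psie. Qed.

Let aactK g : cancel (ah g) (ah g^-1%g).
Proof. by move=> c; rewrite -[LHS]aact_mul mulVg aact1. Qed.

Let aactVK g : cancel (ah g^-1%g) (ah g).
Proof. by move=> c; rewrite -[LHS]aact_mul mulgV aact1. Qed.

(** Translating [ah (k s) e <= e] by [(k s)^-1] gives [e <= ah (k s)^-1 e]; this and [actV_e] are
    its two halves. *)
Let e_actV s : e ** ah (k s)^-1%g e = e.
Proof.
apply: (can_inj (aactK (k s))); rewrite aactM aactVK.
by case: (dilation_act_le s).
Qed.

Let actV_e s : ah (k s)^-1%g e ** e = e.
Proof.
apply: (can_inj (aactK (k s))); rewrite aactM aactVK.
by case: (dilation_act_le s).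
Qed.

Lemma dilation_unit_idem :
  rng_idempotent (skew_const ah e).
Proof.
by rewrite /rng_idempotent skew_monoM aact1 dilation_idem mulg1.
Qed.

Let E := Idem dilation_unit_idem.

(** Moving [e] leftwards past [g] turns it into [ah g e], whence the condition on the right. *)
Let in_corner c g : e ** c = c -> c ** ah g e = c ->
  skew_mono ah c g \in corner_pred E.
Proof.
move=> ec ce; apply/corner_predP.
by rewrite !skew_monoM aact1 ec ce mul1g mulg1.
Qed.

Let dphi_subproof a : skew_mono ah (psi a) 1%g \in corner_pred E.
Proof. by apply: in_corner; rewrite ?aact1 (epsi, psie). Qed.

Let dm_subproof s : skew_mono ah e (k s)^-1%g \in corner_pred E.
Proof. by apply: in_corner; rewrite ?e_actV ?dilation_idem. Qed.

(** Formally this element is [k(s) e], which equals [e k(s) e] because [ah (k s) e <= e]. *)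
Let dp_subproof s : skew_mono ah (ah (k s) e) (k s) \in corner_pred E.
Proof.
by apply: in_corner; [case: (dilation_act_le s) | rewrite -aactM epsi].
Qed.

Let dphi a : corner_ring E := CornerRing (dphi_subproof a).
Let dm s : corner_ring E := CornerRing (dm_subproof s).
Let dp s : corner_ring E := CornerRing (dp_subproof s).

Let dphi_zmod_morphism : zmod_morphism dphi.
Proof.
move=> a b; apply: (addIr (dphi b)); rewrite subrK.
by apply: val_inj; rewrite /= -skew_monoD -psiD subrK.
Qed.

Let dphi_monoid_morphism : GRing.monoid_morphism dphi.
Proof.
split=> [|a b]; apply: val_inj => //=.
by rewrite skew_monoM aact1 psiM mulg1.
Qed.

Let dphi_rmorphism : {rmorphism A -> corner_ring E} :=
  HB.pack dphi
    (GRing.isZmodMorphism.Build A (corner_ring E) dphi dphi_zmod_morphism)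
    (GRing.isMonoidMorphism.Build A (corner_ring E) dphi dphi_monoid_morphism).

Definition dilation_data : fskew_data alpha (corner_ring E).
Proof.
refine (@FskewData N A alpha (corner_ring E) dphi_rmorphism dm dp
          _ _ _ _ _ _ _ _).
- by apply: val_inj; rewrite /= k1 invg1.
- by move=> s t; apply: val_inj; rewrite /= skew_monoM e_actV kM invgM.
- by apply: val_inj; rewrite /= k1 aact1.
- move=> s t; apply: val_inj; rewrite /= skew_monoM -aactM kM aact_mul.
  by congr (skew_mono _ (ah _ _)); case: (dilation_act_le t).
- move=> s a; apply: val_inj.
  by rewrite /= !skew_monoM aact1 -psi_act -!aactM epsi psie mulg1 mul1g.
- move=> s a; apply: val_inj; rewrite /= !skew_monoM aact1 psie mulg1 mul1g.
  by rewrite -psi_act aactK epsi.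
- by move=> s; apply: val_inj; rewrite /= skew_monoM aactK epsi mulVg.
by move=> s; apply: val_inj; rewrite /= skew_monoM -aactM epsi mulgV psi_act.
Defined.

(** The universal property is applied with the corner as target; [Phi] is the resulting map followed
    by the inclusion into the skew group ring. *)
Lemma dilation_map (R : fskew alpha) :
  exists Phi : R -> skew_ring ah,
    [/\ {morph Phi : x y / x + y},
        {morph Phi : x y / x * y >-> x ** y},
        Phi 1 = skew_const ah e,
        forall x, skew_const ah e ** Phi x ** skew_const ah e = Phi x
      & [/\ forall a, Phi (fs_phi R a) = skew_mono ah (psi a) 1%g,
            forall s, Phi (fs_m R s) = skew_mono ah e (k s)^-1%g
          & forall s, Phi (fs_p R s) = skew_mono ah (ah (k s) e) (k s)]].
Proof.
have [F [[F_phi F_m F_p] _]] := @fsk_universal _ _ _ R _ dilation_data.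
exists (fun x => corner_val (F x)); split=> [x y|x y||x|].
- by rewrite rmorphD.
- by rewrite rmorphM.
- by rewrite rmorph1.
- by case: (F x) => y /= /corner_predP[-> ->].
by split=> *; rewrite (F_phi, F_m, F_p).
Qed.

(** Formally the outer factors are [g c] and [c g^-1], so the product is [g (c z c) g^-1]. Both
    sides are additive in [z], which reduces the claim to monomials. *)
Lemma skew_mono_conj g (c : C) (z : skew_ring ah) :
  skew_mono ah (ah g c) g ** z ** skew_mono ah c g^-1%g
  = skew_conj g (skew_const ah c ** z ** skew_const ah c).
Proof.
elim/skew_ind: z => [|x y IHx IHy|d h].
- rewrite !(rmulr0, rmul0r); apply: (addrI (skew_conj g (0 : skew_ring ah))).
  by rewrite -skew_conjD !addr0.
- by rewrite !(rmulDr, rmulDl) skew_conjD IHx IHy.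
rewrite !skew_monoM skew_conj_mono aact1 mul1g mulg1 !aactM.
by rewrite aact_mul.
Qed.

Lemma dilation_equivariant (R : fskew alpha) (Phi : R -> skew_ring ah) :
  {morph Phi : x y / x * y >-> x ** y} ->
  (forall x, skew_const ah e ** Phi x ** skew_const ah e = Phi x) ->
  (forall s, Phi (fs_m R s) = skew_mono ah e (k s)^-1%g) ->
  (forall s, Phi (fs_p R s) = skew_mono ah (ah (k s) e) (k s)) ->
  forall s x, Phi (fs_p R s * x * fs_m R s) = skew_conj (k s) (Phi x).
Proof.
by move=> PhiM PhiE Phim Phip s x; rewrite !PhiM Phim Phip skew_mono_conj PhiE.
Qed.

(* e c g e = s_- a t_+ when g = s^-1 t and s c s^-1 is the image of a. *)
Lemma dilation_surj (R : fskew alpha) (Phi : R -> skew_ring ah) :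
  (forall c g, exists s t a,
     g = ((k s)^-1 * k t)%g /\ ah (k s) c = psi a) ->
  {morph Phi : x y / x + y} ->
  {morph Phi : x y / x * y >-> x ** y} ->
  (forall a, Phi (fs_phi R a) = skew_mono ah (psi a) 1%g) ->
  (forall s, Phi (fs_m R s) = skew_mono ah e (k s)^-1%g) ->
  (forall s, Phi (fs_p R s) = skew_mono ah (ah (k s) e) (k s)) ->
  forall z, corner (skew_const ah e) z -> exists x, Phi x = z.
Proof.
move=> dense PhiD PhiM Phi_phi Phim Phip _ [z ->].
elim/skew_ind: z => [|z1 z2 [x ex] [y ey]|c g].
- exists 0; rewrite rmulr0 rmul0r.
  by apply: (addrI (Phi 0)); rewrite -PhiD !addr0.
- by exists (x + y); rewrite PhiD rmulDr rmulDl ex ey.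
have [s [t [a [-> sc]]]] := dense c g.
exists (fs_m R s * fs_phi R a * fs_p R t).
rewrite !PhiM Phi_phi Phim Phip !skew_monoM aact1 -sc aactK !mulg1 mul1g.
by rewrite aact_mul.
Qed.

End Dilation.

(** * The action of the group of fractions on the localization *)

Lemma tilde_valM (S : revOreMonoidType) :
  {morph @tilde_val S : s t / (s * t)%g}.
Proof. by []. Qed.

Section LocalizationAction.
Variables (S : revOreMonoidType) (B : pzRingType).
Variable beta : endr_action (tilde S) B.
Implicit Types (u v w : tilde S) (g h : lfrac S) (x y : loc beta).
Local Notation "\v" := (@tilde_val S).

(** This is [g u^-1 = v^-1 w] with the inverses cleared. *)
Lemma tilde_frac_mul g u : exists vw : tilde S * tilde S,
  (\v vw.2 * \v u = \v vw.1 * g)%g.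
Proof.
have [s [t e]] := fracP (g * (\v u)^-1)%g.
exists (lamt s, lamt t) => /=; have -> : lam t = (lam s * (g * (\v u)^-1))%g.
  by rewrite e mkfracE mulVKg.
by rewrite -!mulgA mulVg mulg1.
Qed.

(** Makes the action independent both of the representative [(u, b)] and of the fraction [v^-1 w]
    chosen for [g u^-1]. *)
Lemma mkloc_act g u v w u' v' w' b b' :
  (\v w * \v u = \v v * g)%g -> (\v w' * \v u' = \v v' * g)%g ->
  mkloc beta u b = mkloc beta u' b' ->
  mkloc beta v (beta w b) = mkloc beta v' (beta w' b').
Proof.
move=> e e' /mkloc_eq[t1 [t2 [tu tb]]].
(* First a common multiple of [v] and [v'], then one that makes the action on [b] factor through
   [t1]. *)
have [r2 [r1 er]] := oreP v v'; have [q [p ep]] := oreP (r1 * w)%g t1.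
have ep' : (p * (r2 * w') = q * t2)%g.
  (* Cancel [u'] on the right: [p r2 w' u' = p r2 v' g = p r1 v g = p r1 w u = q t1 u = q t2 u']. *)
  apply: (@tilde_mulIg _ u').
  rewrite -[RHS]mulgA -tu [RHS]mulgA ep -!mulgA; congr (_ * _)%g.
  apply: val_inj; rewrite /= e' e !mulgA; congr (_ * _)%g.
  exact: (congr1 \v er).
apply/mkloc_eq; exists (p * r1)%g, (p * r2)%g; split.
  by rewrite -!mulgA er.
rewrite -![beta _ (beta _ _)]eact_mul -!mulgA ep' -ep.
by rewrite !eact_mul /= tb.
Qed.

Definition loc_act0 g x : loc beta :=
  let vw := projT1 (cid (tilde_frac_mul g (repr x).1)) in
  mkloc beta vw.1 (beta vw.2 (repr x).2).

(* g u^-1 b u g^-1 = v^-1 (w b w^-1) v when g u^-1 = v^-1 w. *)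
Lemma loc_act0E g u v w b : (\v w * \v u = \v v * g)%g ->
  loc_act0 g (mkloc beta u b) = mkloc beta v (beta w b).
Proof.
move=> e; rewrite /loc_act0; case: cid => vw /= e'.
by apply: mkloc_act e' e _; rewrite /mkloc -surjective_pairing reprK.
Qed.

Fact loc_actD g : {morph loc_act0 g : x y / x + y}.
Proof.
move=> x y; have [u [b [c [-> ->]]]] := loc_common2 x y.
have [[v w] /= e] := tilde_frac_mul g u.
rewrite (@mklocD _ _ _ u b u c 1%g 1%g) // !(loc_act0E _ e).
rewrite (@mklocD _ _ _ v _ v _ 1%g 1%g) // !mul1g !eact1.
by rewrite (loc_act0E _ e) eactD.
Qed.

Fact loc_actM g : {morph loc_act0 g : x y / x ** y}.
Proof.
move=> x y; have [u [b [c [-> ->]]]] := loc_common2 x y.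
have [[v w] /= e] := tilde_frac_mul g u.
rewrite (@mklocM _ _ _ u b u c 1%g 1%g) // !(loc_act0E _ e).
rewrite (@mklocM _ _ _ v _ v _ 1%g 1%g) // !mul1g !eact1.
by rewrite (loc_act0E _ e) eactM.
Qed.

Fact loc_act1 : loc_act0 1%g =1 id.
Proof.
move=> x; have [u [b ->]] := locP x.
by rewrite (@loc_act0E _ u u 1%g) ?mulg1 ?eact1 //= mul1g.
Qed.

(** If [h u^-1 = v^-1 w] and [g v^-1 = v'^-1 w'], then [g h u^-1 = v'^-1 (w' w)]. *)
Fact loc_act_mul g h : loc_act0 (g * h)%g =1 loc_act0 g \o loc_act0 h.
Proof.
move=> x; have [u [b ->]] := locP x.
have [[v w] /= e] := tilde_frac_mul h u.
have [[v' w'] /= e'] := tilde_frac_mul g v.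
rewrite /= (loc_act0E _ e) (loc_act0E _ e') -[beta w' _]eact_mul.
by apply: loc_act0E; rewrite /= -mulgA e !mulgA e'.
Qed.

Definition loc_act : aut_action (lfrac S) (loc beta) :=
  AutAction loc_actD loc_actM loc_act1 loc_act_mul.

Lemma loc_actE g u v w b : (\v w * \v u = \v v * g)%g ->
  loc_act g (mkloc beta u b) = mkloc beta v (beta w b).
Proof. exact: loc_act0E. Qed.

Lemma loc_act_tilde w b :
  loc_act (\v w) (mkloc beta 1%g b) = mkloc beta 1%g (beta w b).
Proof. by apply: loc_actE; rewrite mulg1 mul1g. Qed.

Lemma mkloc1D : {morph mkloc beta 1%g : b c / b + c}.
Proof.
by move=> b c; rewrite (@mklocD _ _ _ _ _ _ _ 1%g 1%g) // mul1g !eact1.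
Qed.

Lemma mkloc1M : {morph mkloc beta 1%g : b c / b * c >-> b ** c}.
Proof.
by move=> b c; rewrite (@mklocM _ _ _ _ _ _ _ 1%g 1%g) // mul1g !eact1.
Qed.

Lemma mkloc1_inj : (forall w, injective (beta w)) ->
  injective (mkloc beta 1%g).
Proof.
move=> binj b c /mkloc_eq[t1 [t2 []]].
by rewrite !mulg1 => -> /binj.
Qed.

End LocalizationAction.

(** * The map from [A] to [S_- A S_+] *)

Section MinusPlusTheory.
Variables (S : revOreMonoidType) (A : pzRingType) (alpha : endr_action S A).
Variables (R : pzRingType) (r : fskew_data alpha R).

Lemma SAS_phiD : {morph SAS_phi r : a b / a + b}.
Proof. by move=> a b; apply: val_inj; rewrite /= rmorphD. Qed.

Lemma SAS_phiM : {morph SAS_phi r : a b / a * b}.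
Proof. by move=> a b; apply: val_inj; rewrite /= rmorphM. Qed.

(** Moving [s_+] past [a] leaves the factor [alpha s 1], which [alpha s a] absorbs. *)
Lemma SAS_act_phi s a : SAS_act r s (SAS_phi r a) = SAS_phi r (alpha s a).
Proof.
apply: val_inj => /=.
by rewrite fs_p_phi -mulrA fs_pm -rmorphM -eactM mulr1.
Qed.

(** For [b = s_- a s_+], conjugation by [s] gives [p_s a p_s], where [p_s = alpha s 1]. *)
Lemma SAS_act_in_phi (b : SAS r) : exists s a, SAS_act r s b = SAS_phi r a.
Proof.
case: b => b bP; have [s [a eb]] := SAS_predP _ _ bP.
exists s, (alpha s 1 * a * alpha s 1); apply: val_inj.
by rewrite /= eb !rmorphM -fs_pm !mulrA.
Qed.

End MinusPlusTheory.

(** * Nonvanishing of the idempotent and assembly of [Phi] *)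

Lemma skew_const_eq0 (G : groupType) (C : rngType) (ah : aut_action G C) c :
  skew_const ah c = 0 -> c = 0.
Proof. by move/eqP; rewrite [_ == _]monalgU_eq0 => /eqP. Qed.

(** The dilation with [psi b = [1, b]] sends the unit of [T] to the constant [[1, 1]], and [[1, -]]
    is injective because [beta] is. *)
Lemma fskew_oner_neq0 (S : revOreMonoidType) (B : pzRingType)
    (beta : endr_action (tilde S) B) (T : fskew beta) :
  (forall s, injective (beta s)) -> (1 : T) = 0 -> (1 : B) = 0.
Proof.
move=> beta_inj T0.
have [Phi [PhiD _ Phi1 _ _]] :=
  dilation_map (erefl : tilde_val 1%g = 1%g) (@tilde_valM S)
  (@mkloc1D _ _ beta) (@mkloc1M _ _ beta) (@loc_act_tilde _ _ beta) T.
apply: (mkloc1_inj beta_inj); apply: (@skew_const_eq0 _ _ (loc_act beta)).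
rewrite -Phi1 T0.
by apply: (addrI (Phi 0)); rewrite -PhiD !addr0.
Qed.

(** [R] and [T] are arbitrary models of the two universal rings. The condition for [e != 0] says
    that [A/I] is nonzero; otherwise the whole localization vanishes. *)
Theorem theorem5p3 (A : pzRingType) (S : revOreMonoidType)
    (alpha : endr_action S A)
    (R : fskew alpha) (T : fskew (tilde_quot_act alpha)) :
  exists ah : aut_action (lfrac S) (loc (SAS_act T)),
    (forall (s : S) (a : A),
       ah (lam s) (mkloc (SAS_act T) 1%g (SAS_phi T (kerU_pi alpha a)))
       = mkloc (SAS_act T) 1%g (SAS_phi T (kerU_pi alpha (alpha s a)))) /\
    exists e : loc (SAS_act T),
      [/\ (1 : A) \notin kerU alpha -> e != 0,
          rng_idempotent e,
          forall s : S, idem_le (ah (lam s) e) e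
        & exists Phi : R -> skew_ring ah,
            [/\ {morph Phi : x y / x + y},
                {morph Phi : x y / x * y >-> x ** y},
                Phi 1 = skew_const ah e,
                forall z : skew_ring ah,
                  corner (skew_const ah e) z <-> exists x : R, Phi x = z
              & forall (s : S) (x : R),
                  Phi (fs_p R s * x * fs_m R s)
                  = skew_conj (lam s) (Phi x)]].
Proof.
pose beta := SAS_act T; pose ah := loc_act beta.
(* The composite of [A -> A/I], the map to [S~_- (A/I) S~_+], and [b |-> [1, b]]. *)
pose psi a := mkloc beta 1%g (SAS_phi T (kerU_pi alpha a)).
have psiD : {morph psi : a b / a + b}.
  by move=> a b; rewrite /psi kerU_piD SAS_phiD mkloc1D.
have psiM : {morph psi : a b / a * b >-> a ** b}.
  by move=> a b; rewrite /psi -kerU_piM SAS_phiM mkloc1M.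
have psi_act s a : ah (lam s) (psi a) = psi (alpha s a).
  rewrite -[lam s]/(tilde_val (lamt s)) [LHS]loc_act_tilde.
  by rewrite [beta _ _]SAS_act_phi tilde_quot_actE.
have lamM : {morph @lam S : s t / (s * t)%g} by move=> s t; rewrite gmulfM.
have dense c g : exists s t a,
    g = ((lam s)^-1 * lam t)%g /\ ah (lam s) c = psi a.
  have [u [b ->]] := locP c; have [s0 [t0 ->]] := fracP g.
  have [w [x wb]] := SAS_act_in_phi b.
  (* Acting by [w] brings [b] into the image of [A/I]. The Ore condition gives [r w u = q' lamt s0],
     so [q s0] is a denominator of [g] and also sends [[u, b]] to [[1, beta_(r w) b]]. *)
  have [r [q' e]] := oreP (lamt s0) (w * u)%g; have [q eq] := lamtP q'.
  have [a ea] := kerU_piP (tilde_quot_act alpha r x).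
  exists (q * s0)%g, (q * t0)%g, a; split; first by rewrite -mkfracE mkfracMl.
  rewrite (@loc_actE _ _ _ _ _ 1%g (r * w)%g); last first.
    have ers : (r * w * u = 1 * lamt (q * s0))%g.
      by rewrite mul1g lamtM eq -e mulgA.
    by have := congr1 (@tilde_val S) ers; rewrite !tilde_valM.
  by rewrite /psi -ea -SAS_act_phi -wb eact_mul.
exists ah; split=> //; exists (psi 1); split.
(* If [[1, 1] = [1, 0]], then [1 = 0] in [T], hence in [A/I], so [1] lies in [I]. *)
- apply: contra => /eqP e0; apply/kerUP.
  suff /kerUP : (1 - 0 : A) \in kerU alpha by rewrite subr0.
  apply/kerU_piE; rewrite kerU_pi0.
  apply: (fskew_oner_neq0 (T := T)); first exact: tilde_quot_act_inj.
  have /(congr1 val) := mkloc1_inj (@SAS_act_inj _ _ _ _ T) e0.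
  by rewrite /= rmorph1.
- exact: dilation_idem psiM.
- exact: dilation_act_le psiM psi_act.
have [Phi [PhiD PhiM Phi1 PhiE [Phi_phi Phim Phip]]] :=
  dilation_map (erefl : @lam S 1%g = 1%g) lamM psiD psiM psi_act R.
exists Phi; split=> // [z|].
  split; first exact: (dilation_surj dense PhiD PhiM Phi_phi Phim Phip).
  by case=> x <-; exists (Phi x).
exact: (dilation_equivariant PhiM PhiE Phim Phip).
Qed.
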